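(* Let $\mathcal{A},\mathcal{B}\subseteq M_n$ be unital $*$-subalgebras of $M_n$, written as $$\mathcal{A} = U\Big(\bigoplus_{k=1}^{d_1} (M_{a_k}\otimes I_{m_k})\Big)U^*,\qquad \mathcal{B} = V\Big(\bigoplus_{k=1}^{d_2} (M_{b_k}\otimes I_{n_k})\Big)V^*,$$ where $U,V\in M_n$ are unitary, $a_k,m_k,b_k,n_k$ are positive integers, and $\sum_{k=1}^{d_1}a_km_k=n=\sum_{k=1}^{d_2}b_kn_k$. Let $X=X(U,V)$ be their block-index matrix, and let $$r=(\underbrace{m_1,\dots,m_1}_{a_1},\dots,\underbrace{m_{d_1},\dots,m_{d_1}}_{a_{d_1}}),\qquad c=(\underbrace{n_1,\dots,n_1}_{b_1},\dots,\underbrace{n_{d_2},\dots,n_{d_2}}_{b_{d_2}}).$$ Then $$Q(\mathcal{A},\mathcal{B})=\|Y(X;r,c)\|_F^2+\sum_{k=1}^{d_1}\sum_{\ell=1}^{d_2}\frac{1}{m_kn_\ell}\gamma_{k,\ell}.$$ Consequently, $\mathcal{A}$ and $\mathcal{B}$ are quasiorthogonal if and only if both of the following hold: (i) $X$ is quasiable with respect to $r$ and $c$; (ii) for all $1\le k\le d_1$ and $1\le \ell\le d_2$, the multi-set of matrices $\Gamma_{k,\ell}$ forms an orthogonal set in the trace inner product (i.e. members with distinct indices are orthogonal).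
   Context: $M_n$ is the algebra of $n\times n$ complex matrices; the trace inner product is $\langle X,Y\rangle=\mathrm{Tr}(XY^* )$ (also for rectangular matrices of equal size), and $\|\cdot\|_F$ is the Frobenius norm. A unital $*$-subalgebra of $M_n$ is a complex subalgebra closed under conjugate transpose and containing $I_n$. In $M_a\otimes I_m$, the element $[x_{ij}]\otimes I_m$ is the $a\times a$ block matrix with $(i,j)$-block $x_{ij}I_m$. Quasiorthogonality: $\mathcal{A},\mathcal{B}$ are quasiorthogonal if $\mathrm{Tr}(AB)=\frac{\mathrm{Tr}(A)\mathrm{Tr}(B)}{n}$ for all $A\in\mathcal{A}$, $B\in\mathcal{B}$. Measure of orthogonality: let $\mathcal{E}_{\mathcal{A}}$ be the trace-preserving conditional expectation onto $\mathcal{A}$, i.e. the orthogonal projection of $M_n$ onto $\mathcal{A}$ in the trace inner product. Then $Q(\mathcal{A},\mathcal{B}):=\mathrm{Tr}(T_{\mathcal{A}}T_{\mathcal{B}})$, where $T_{\mathcal{A}},T_{\mathcal{B}}$ are the matrices of $\mathcal{E}_{\mathcal{A}},\mathcal{E}_{\mathcal{B}}$ as linear operators on $M_n$ in a common basis. Equivalently, $Q(\mathcal{A},\mathcal{B})=\sum_{i,j}|\mathrm{Tr}(A_iB_j)|^2$ for orthonormal bases $\{A_i\}$ of $\mathcal{A}$ and $\{B_j\}$ of $\mathcal{B}$ in the trace inner product. Block-index matrix: $X(U,V)=(U^*V)\circ(\overline{U^*V})$ with $\circ$ the entrywise product; that is, $X_{i,j}=|(U^*V)_{i,j}|^2$.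 It is doubly stochastic. For tuples of positive integers $r=(r_1,\dots,r_s)$ and $c=(c_1,\dots,c_t)$ each summing to $n$, partition the rows of an $n\times n$ matrix into consecutive groups of sizes $r_1,\dots,r_s$ and its columns into consecutive groups of sizes $c_1,\dots,c_t$. $Y(X;r,c)$ is the $s\times t$ matrix whose $(i,j)$ entry is $\frac{1}{\sqrt{r_ic_j}}$ times the sum of all entries in the $(i,j)$-block of $X$. A doubly stochastic $n\times n$ matrix $D$ is quasiable with respect to $r$ and $c$ if for all $i,j$ the sum of all entries in its $(i,j)$-block equals $\frac{r_ic_j}{n}$. Partitioned columns: partition the columns of $U$ consecutively into $U_1,\dots,U_{d_1}$, where $U_k$ has $a_km_k$ columns, and partition $U_k$ consecutively into $U_{k,1},\dots,U_{k,a_k}$, each with $m_k$ columns. Similarly partition $V$ into $V_1,\dots,V_{d_2}$, where $V_\ell$ has $b_\ell n_\ell$ columns, and $V_\ell$ into $V_{\ell,1},\dots,V_{\ell,b_\ell}$, each with $n_\ell$ columns. For $1\le k\le d_1$, $1\le\ell\le d_2$, $\Gamma_{k,\ell}$ is the multi-set (indexed family) of $m_k\times n_\ell$ matrices $\{U_{k,p}^*V_{\ell,q} : 1\le p\le a_k,\ 1\le q\le b_\ell\}$, and $\gamma_{k,\ell}$ is the sum of the squared moduli of the trace inner products over all ordered pairs of members of $\Gamma_{k,\ell}$ with distinct indices: $$\gamma_{k,\ell}=\sum_{\substack{1\le p,q\le a_k,\ 1\le u,v\le b_\ell\\ (p,v)\ne(q,u)}}\Big|\mathrm{Tr}\big((U_{k,p}^*V_{\ell,v})^*(U_{k,q}^*V_{\ell,u})\big)\Big|^2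 .$$ *)

(* Defs.v *)
From HB Require Import structures.
From mathcomp Require Export all_boot all_order all_algebra.
From mathcomp Require Export spectral sesquilinear.
From mathcomp Require Export reals complex mxtens.

Set Implicit Arguments.
Unset Strict Implicit.
Unset Printing Implicit Defensive.

Import Order.TTheory GRing.Theory Num.Theory.
Local Open Scope ring_scope.
Local Open Scope sesquilinear_scope.

(* Everything is set up over a numClosedFieldType [C]; the main theorem takes
   [C := R[i]] with [R : realType].  Real quantities (squared moduli, norms)
   are elements of [C], where [0 <= x] means that [x] is real and
   nonnegative. *)

Section TraceInnerProduct.
Variable C : numClosedFieldType.

Definition trdot m n (X Y : 'M[C]_(m, n)) : C := \tr (X *m Y^t*).

Lemma trdotE m n (X Y : 'M[C]_(m, n)) :
  trdot X Y = \sum_i \sum_j X i j * (Y i j)^*.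
Proof.
by apply: eq_bigr => i _; rewrite mxE; apply: eq_bigr => j _; rewrite !mxE.
Qed.

Fact trdot_bilinear m n :
  bilinear_for
    (GRing.Scale.Law.clone _ _ *%R _)
    (GRing.Scale.Law.clone _ _ (Num.conj \; *%R) _) (@trdot m n).
Proof.
split=> [Y|X] k Z T /=; rewrite /trdot.
  by rewrite mulmxDl linearD/= -scalemxAl linearZ.
rewrite [in LHS]linearD/= map_mxD mulmxDr linearD/= linearZ/= map_mxZ.
by rewrite -scalemxAr linearZ.
Qed.

HB.instance Definition _ m n := bilinear_isBilinear.Build C _ _ _
  (GRing.Scale.Law.clone _ _ *%R _)
  (GRing.Scale.Law.clone _ _ (Num.conj \; *%R) _) (@trdot m n)
  (@trdot_bilinear m n).

Fact trdot_hermitian m n (X Y : 'M[C]_(m, n)) :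
  trdot X Y = (-1) ^+ false * Num.conj (trdot Y X).
Proof.
rewrite expr0 mul1r !trdotE rmorph_sum; apply: eq_bigr => i _.
rewrite rmorph_sum; apply: eq_bigr => j _.
by rewrite rmorphM/= conjCK mulrC.
Qed.

HB.instance Definition _ m n :=
  isHermitianSesquilinear.Build C _ false Num.conj (@trdot m n)
    (@trdot_hermitian m n).

Fact trdot_gt0 m n (X : 'M[C]_(m, n)) : X != 0 -> 0 < trdot X X.
Proof.
move=> X0; have s_ge0 i : 0 <= \sum_j X i j * (X i j)^*.
  by apply: sumr_ge0 => j _; rewrite mul_conjC_ge0.
rewrite trdotE lt_def sumr_ge0 ?andbT => [|i _ //].
apply: contra X0 => /eqP s0; apply/eqP/matrixP => i j; rewrite mxE.
move/psumr_eq0P: s0 => /(_ (fun i _ => s_ge0 i) i isT).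
move/psumr_eq0P => /(_ _ j isT) H; apply/eqP.
by rewrite -mul_conjC_eq0 H// => k _; rewrite mul_conjC_ge0.
Qed.

HB.instance Definition _ m n :=
  isDotProduct.Build C _ (@trdot m n) (@trdot_gt0 m n).

Definition orthogonal_family (I : finType) m n (G : I -> 'M[C]_(m, n)) : Prop :=
  forall i j, i != j -> trdot (G i) (G j) = 0.

Definition frobenius_norm m n (X : 'M[C]_(m, n)) : C :=
  sqrtC (\sum_i \sum_j `|X i j| ^+ 2).

End TraceInnerProduct.

Section Subalgebras.
Variables (C : numClosedFieldType) (n : nat).
Implicit Types A B : {vspace 'M[C]_n}.

Definition unital_star_subalgebra A : Prop :=
  [/\ 1%:M \in A,
      forall x y, x \in A -> y \in A -> x *m y \in A
    & forall x, x \in A -> x^t* \in A].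

Definition quasiorthogonal A B : Prop :=
  forall x y, x \in A -> y \in B -> \tr (x *m y) = \tr x * \tr y / n%:R.

(* The projection of M_n onto A along the orthogonal complement of A. *)
Definition cond_exp A : 'End('M[C]_n) :=
  daddv_pi A (orthov (@trdot C n n) A).

Lemma cond_exp_mem A x : cond_exp A x \in A.
Proof. exact: memv_pi. Qed.

Let orthov_cap A : (A :&: orthov (@trdot C n n) A = 0)%VS.
Proof.
apply/eqP; rewrite -subv0; apply/subvP => x.
rewrite memv_cap => /andP[xA /mem_orthovP/(_ _ xA) x0].
by rewrite memv0; apply: contraTT isT => /trdot_gt0; rewrite x0 ltxx.
Qed.

Let dim_bigcap_lker k (f : 'I_k -> 'Hom('M[C]_n, C^o)) :
  (\dim {:'M[C]_n} <= k + \dim (\bigcap_(i < k) lker (f i)))%N.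
Proof.
elim: k f => [|k IHk] f; first by rewrite big_ord0 add0n.
rewrite big_ord_recr/=; set W := (\bigcap_(i < k) _)%VS.
apply: leq_trans (IHk (fun i => f (widen_ord (leqnSn k) i))) _.
rewrite -/W addSnnS leq_add2l -(limg_ker_dim (f ord_max) W).
rewrite -[leqRHS]addn1 leq_add2l (leq_trans (dimvS (subvf _)))//.
by rewrite dimvf.
Qed.

Let orthov_add A : (A + orthov (@trdot C n n) A = fullv)%VS.
Proof.
apply/eqP; rewrite eqEdim subvf dimv_disjoint_sum ?orthov_cap//=.
exact: dim_bigcap_lker.
Qed.

Lemma cond_exp_orth A x y : y \in A -> trdot (x - cond_exp A x) y = 0.
Proof.
move=> yA; have /(daddv_pi_add (orthov_cap A)) :
  x \in (A + orthov (@trdot C n n) A)%VS by rewrite orthov_add memvf.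
move=> {1}<-; rewrite addrC addKr.
by have /mem_orthovP/(_ _ yA) := memv_pi (orthov (@trdot C n n) A) A x.
Qed.

(* [lin_mx f] is the matrix of [f] in the standard basis of M_n, acting on row
   vectors; the transposition this entails does not change the trace of the
   product. *)
Definition Qmeasure A B : C :=
  \tr (lin_mx (cond_exp A) *m lin_mx (cond_exp B)).

Section Decomposition.
Variables (d : nat) (a m : 'I_d -> nat).
Hypothesis amn : (\sum_(k < d) a k * m k)%N = n.

(* A = U (\bigoplus_k M_(a k) \otimes I_(m k)) U^* *)
Definition block_decomposition (U : 'M[C]_n) A : Prop :=
  forall x, x \in A <->
    exists y : forall k, 'M[C]_(a k),
      x = U *m castmx (amn, amn) (\mxdiag_(k < d) (y k *t (1%:M : 'M[C]_(m k))))
            *m U^t*.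

(* U_{k,p}: column j of U_{k,p} is column p * m_k + j of U_k, where U_k consists
   of a_k m_k consecutive columns of U. *)
Definition col_block (U : 'M[C]_n) (k : 'I_d) (p : 'I_(a k)) : 'M[C]_(n, m k) :=
  colsub (fun j : 'I_(m k) => mxtens_index (p, j))
    (submxrow (castmx (erefl n, esym amn) U) k).

(* (m_1, ..., m_1, ..., m_d, ..., m_d), with a_k copies of m_k *)
Definition block_sizes : seq nat :=
  flatten [seq nseq (a k) (m k) | k <- enum 'I_d].

End Decomposition.

Definition block_index_mx (U V : 'M[C]_n) : 'M[C]_n :=
  \matrix_(i, j) `|(U^t* *m V) i j| ^+ 2.

Definition doubly_stochastic (D : 'M[C]_n) : Prop :=
  [/\ forall i j, 0 <= D i j,
      forall i, \sum_j D i j = 1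
    & forall j, \sum_i D i j = 1].

(* [reshape_index r x] is the position in [r] of the consecutive group that
   contains x, when {0, ..., sumn r - 1} is cut into groups of sizes given
   by [r]. *)
Definition block_sum (r c : seq nat) (D : 'M[C]_n) (i j : nat) : C :=
  \sum_(x < n | reshape_index r x == i)
    \sum_(y < n | reshape_index c y == j) D x y.

Definition Ymx (r c : seq nat) (D : 'M[C]_n) : 'M[C]_(size r, size c) :=
  \matrix_(i, j) ((sqrtC (nth 0%N r i * nth 0%N c j)%N%:R)^-1 * block_sum r c D i j).

Definition quasiable (r c : seq nat) (D : 'M[C]_n) : Prop :=
  doubly_stochastic D /\
  forall (i : 'I_(size r)) (j : 'I_(size c)),
    block_sum r c D i j = (nth 0%N r i * nth 0%N c j)%N%:R / n%:R.

End Subalgebras.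

Section Gamma.
Variables (C : numClosedFieldType) (n d1 d2 : nat).
Variables (a m : 'I_d1 -> nat) (b l : 'I_d2 -> nat).
Hypotheses (amn : (\sum_(k < d1) a k * m k)%N = n)
           (bln : (\sum_(k < d2) b k * l k)%N = n).
Variables U V : 'M[C]_n.

Definition Gamma (i : 'I_d1) (j : 'I_d2) (pv : 'I_(a i) * 'I_(b j)) :
    'M[C]_(m i, l j) :=
  (col_block amn U pv.1)^t* *m col_block bln V pv.2.

Definition gamma (i : 'I_d1) (j : 'I_d2) : C :=
  \sum_(p < a i) \sum_(q < a i) \sum_(u < b j) \sum_(v < b j | (p, v) != (q, u))
    `|\tr ((Gamma (p, v))^t* *m Gamma (q, u))| ^+ 2.

End Gamma.

Arguments Gamma {C n d1 d2 a m b l} amn bln U V i j pv.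
Arguments gamma {C n d1 d2 a m b l} amn bln U V i j.

(* Main.v *)
(* The matrices U_{k,p} U_{k,q}^* (images under conjugation by U of the matrix
   units tensored with identities) form an orthogonal basis of A, with squared
   norms m_k, and similarly for B.  Expanding the two projections in these bases
   gives Q(A, B) as the weighted sum of the squared inner products
   Tr(Gamma_{p,v}^* Gamma_{q,u}), and quasiorthogonality need only be tested on
   basis elements.  The terms with (p, v) = (q, u) are the block sums of X,
   because Tr(Gamma_{p,v}^* Gamma_{p,v}) adds up the squared moduli of the
   entries of one block of U^*V; the other terms make up gamma. *)
Require Import Defs.

Set Implicit Arguments.
Unset Strict Implicit.
Unset Printing Implicit Defensive.

Import Order.TTheory GRing.Theory Num.Theory.
Local Open Scope ring_scope.
Local Open Scope sesquilinear_scope.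

(** * Sums over concatenated and tensor-product indices *)

Lemma sum_tagnat (V : nmodType) d (a : 'I_d -> nat)
    (F : 'I_(\sum_(k < d) a k) -> V) :
  \sum_x F x = \sum_k \sum_(p < a k) F (tagnat.Rank k p).
Proof.
rewrite (reindex _ tagnat.rank_bij_on) sig_big_dep/=.
by apply: eq_bigr => p _; rewrite tagnat.rankE.
Qed.

Lemma sum_mxtens_index (V : nmodType) a m (F : 'I_(a * m) -> V) :
  \sum_x F x = \sum_p \sum_j F (mxtens_index (p, j)).
Proof.
rewrite pair_big (reindex (@mxtens_index a m))/=.
  by apply: eq_bigr => -[].
by apply: onW_bij; exists (@mxtens_unindex a m);
  [exact: mxtens_indexK|exact: mxtens_unindexK].
Qed.

(** * Positions of columns and of groups in a block decomposition *)

Section BlockIndices.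
Variables (n d : nat) (a m : 'I_d -> nat).
Hypothesis amn : (\sum_(k < d) a k * m k)%N = n.

(** The column of [U] that serves as column [j] of U_{k,p}; the triples (k, p, j) are coordinates on
    ['I_n]. *)
Definition col_pos k (p : 'I_(a k)) (j : 'I_(m k)) : 'I_n :=
  cast_ord amn (tagnat.Rank k (mxtens_index (p, j))).

Lemma col_posE k (p : 'I_(a k)) (j : 'I_(m k)) :
  col_pos p j = (\sum_(i < d | (i < k)%N) a i * m i + (p * m k + j))%N :> nat.
Proof. exact: tagnat.RankEsum. Qed.

(** The inner indices are compared as natural numbers because their types depend on [k] and [k']. *)
Lemma eq_col_pos k (p : 'I_(a k)) (i : 'I_(m k))
    k' (q : 'I_(a k')) (j : 'I_(m k')) :
  (col_pos p i == col_pos q j)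
  = [&& k == k', (p == q :> nat) & (i == j :> nat)].
Proof.
rewrite -val_eqE/= tagnat.eq_Rank; case: eqVneq => //= ek.
case: _ / ek in q j *; have /= := can_eq (@mxtens_indexK _ _) (p, i) (q, j).
by rewrite xpair_eqE -!val_eqE.
Qed.

Lemma sum_col_pos (V : nmodType) (F : 'I_n -> V) :
  \sum_x F x = \sum_k \sum_(p < a k) \sum_(j < m k) F (col_pos p j).
Proof.
rewrite (reindex (cast_ord amn)) /=; last first.
  by apply: onW_bij; exists (cast_ord (esym amn)) => x;
  rewrite ?cast_ordK ?cast_ordKV.
rewrite sum_tagnat.
by apply: eq_bigr => k _; rewrite sum_mxtens_index.
Qed.

Lemma col_blockE (C : numClosedFieldType) (U : 'M[C]_n) k (p : 'I_(a k)) i j :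
  col_block amn U p i j = U i (col_pos p j).
Proof. by rewrite /col_block !mxE castmxE/= cast_ord_id esymK. Qed.

(** Isolates the run of copies of [m k]. The length and the sum of the part before it are the
    offsets in [block_posE] and [col_posE], so [nth] and [take] can be evaluated at those
    positions. *)
Lemma block_sizes_split (k : 'I_d) : exists s1 s2,
  [/\ block_sizes a m = s1 ++ nseq (a k) (m k) ++ s2,
      size s1 = \sum_(i < d | (i < k)%N) a i
    & sumn s1 = \sum_(i < d | (i < k)%N) a i * m i]%N.
Proof.
have takeE : take k (enum 'I_d) = [seq i : 'I_d <- enum 'I_d | (i < k)%N].
  apply: (inj_map val_inj); rewrite map_take val_enum_ord take_iota.
  rewrite -(filter_map (@nat_of_ord d) (fun i => i < k)%N) val_enum_ord.
  by rewrite (@filter_iota_ltn 0) ?(minn_idPl _)// ltnW.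
exists (flatten [seq nseq (a i) (m i) | i <- take k (enum 'I_d)]).
exists (flatten [seq nseq (a i) (m i) | i <- drop k.+1 (enum 'I_d)]).
split.
- rewrite /block_sizes -{1}(cat_take_drop k (enum 'I_d)).
  rewrite (drop_nth k) ?size_enum_ord// nth_ord_enum.
  by rewrite map_cat flatten_cat.
- rewrite takeE size_flatten /shape -map_comp sumnE big_map big_filter.
  by rewrite big_enum_cond/=; apply: eq_bigr => i _; rewrite size_nseq.
- rewrite takeE sumn_flatten -map_comp sumnE big_map big_filter.
  by rewrite big_enum_cond/=; apply: eq_bigr => i _; rewrite sumn_nseq mulnC.
Qed.

Lemma size_block_sizes : size (block_sizes a m) = (\sum_(k < d) a k)%N.
Proof.
rewrite size_flatten /shape -map_comp sumnE big_map big_enum/=.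
by apply: eq_bigr => i _; rewrite size_nseq.
Qed.

(** The position in the list of group sizes of copy [p] of [m k], counted from zero. *)
Definition block_pos k (p : 'I_(a k)) : 'I_(size (block_sizes a m)) :=
  cast_ord (esym size_block_sizes) (tagnat.Rank k p).

Lemma sum_block_pos (V : nmodType) (F : 'I_(size (block_sizes a m)) -> V) :
  \sum_x F x = \sum_k \sum_(p < a k) F (block_pos p).
Proof.
rewrite (reindex (cast_ord (esym size_block_sizes))) /=; last first.
  apply: onW_bij; exists (cast_ord size_block_sizes) => x;
  by rewrite ?cast_ordK ?cast_ordKV.
by rewrite sum_tagnat.
Qed.

Lemma block_posP x : exists k (p : 'I_(a k)), x = block_pos p.
Proof.
exists (tagnat.sig1 (cast_ord size_block_sizes x)).
exists (tagnat.sig2 (cast_ord size_block_sizes x)).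
by rewrite /block_pos tagnat.sig2K cast_ordK.
Qed.

Lemma block_posE k (p : 'I_(a k)) :
  block_pos p = (\sum_(i < d | (i < k)%N) a i + p)%N :> nat.
Proof. exact: tagnat.RankEsum. Qed.

Lemma eq_block_pos k (p : 'I_(a k)) k' (q : 'I_(a k')) :
  (block_pos p == block_pos q :> nat) = (k == k') && (p == q :> nat).
Proof. exact: tagnat.eq_Rank. Qed.

Lemma nth_block_pos k (p : 'I_(a k)) :
  nth 0%N (block_sizes a m) (block_pos p) = m k.
Proof.
rewrite block_posE; have [s1 [s2 [-> <- _]]] := block_sizes_split k.
rewrite nth_cat ltnNge leq_addr/= addKn.
by rewrite nth_cat size_nseq ltn_ord nth_nseq ltn_ord.
Qed.

(** [col_pos p j] is the flat index of offset [j] in group [block_pos p], and [reshape_index]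
    recovers the group because [j] is below its size [m k]. *)
Lemma reshape_index_col_pos k (p : 'I_(a k)) j :
  reshape_index (block_sizes a m) (col_pos p j) = block_pos p.
Proof.
rewrite -(@flatten_indexKl (block_sizes a m) (block_pos p) j) ?nth_block_pos//.
congr reshape_index; rewrite /flatten_index block_posE col_posE.
have [s1 [s2 [-> <- <-]]] := block_sizes_split k.
rewrite take_cat ltnNge leq_addr/= addKn.
rewrite take_cat size_nseq ltn_ord sumn_cat take_nseq ?sumn_nseq 1?ltnW//.
by rewrite /= addnA [(m k * _)%N]mulnC.
Qed.

Lemma sum_reshape_index (V : nmodType) (F : 'I_n -> V) k (p : 'I_(a k)) :
  \sum_(x < n | reshape_index (block_sizes a m) x == block_pos p) F x
  = \sum_(j < m k) F (col_pos p j).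
Proof.
rewrite big_mkcond sum_col_pos (bigD1 k)//= (bigD1 p)//=.
rewrite [X in _ + X + _]big1 => [|q qp]; last first.
  rewrite big1// => j _; rewrite reshape_index_col_pos.
  by rewrite eq_block_pos eqxx val_eqE (negPf qp).
rewrite [X in _ + X]big1 => [|k' kk']; last first.
  rewrite big1// => q _; rewrite big1// => j _; rewrite reshape_index_col_pos.
  by rewrite eq_block_pos (negPf kk').
by rewrite !addr0; apply: eq_bigr => j _; rewrite reshape_index_col_pos eqxx.
Qed.

End BlockIndices.

(** * Projections and quasiorthogonality in orthogonal bases *)

Section OrthogonalBasis.
Variables (C : numClosedFieldType) (n : nat).
Implicit Types (A B : {vspace 'M[C]_n}).

(** The basis is left unnormalised, with squared norms [w], which avoids square roots of
    multiplicities. Independence follows from orthogonality and [w i != 0]. *)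
Definition orthogonal_basis (I : finType) A (e : I -> 'M[C]_n) (w : I -> C) :=
  [/\ forall i, w i != 0,
      forall i j, trdot (e i) (e j) = (i == j)%:R * w i
    & forall x, x \in A <-> exists y : I -> C, x = \sum_i y i *: e i].

Lemma trdot_conj (x y : 'M[C]_n) : trdot x y = (trdot y x)^*.
Proof. by rewrite trdot_hermitian expr0 mul1r. Qed.

Lemma orthogonal_basis_mem I A e w i : @orthogonal_basis I A e w -> e i \in A.
Proof.
case=> _ _ eA; apply/eA; exists (fun j => (j == i)%:R).
rewrite (bigD1 i)//= eqxx scale1r big1 ?addr0// => j /negPf ->.
by rewrite scale0r.
Qed.

(** The candidate [y] minus the projection lies in [A] and is a difference of two elements
    orthogonal to [A]; it is therefore orthogonal to itself and vanishes. *)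
Lemma cond_expE I A e w x : @orthogonal_basis I A e w ->
  cond_exp A x = \sum_i (trdot x (e i) / w i) *: e i.
Proof.
move=> eAw; have [w0 ee eA] := eAw; set y := RHS.
have yA : y \in A by apply/eA; eexists.
have xy_orth i : trdot (x - y) (e i) = 0.
  rewrite linearBl/= linear_sumlz/= (bigD1 i)//= big1 => [|j ji].
    by rewrite linearZl_LR/= ee eqxx mul1r divfK ?addr0 ?subrr.
  by rewrite linearZl_LR/= ee (negPf ji) mul0r mulr0.
have /eqP: trdot (y - cond_exp A x) (y - cond_exp A x) = 0.
  have zA : y - cond_exp A x \in A by rewrite memvB ?cond_exp_mem.
  have zE : y - cond_exp A x = (x - cond_exp A x) - (x - y).
    by rewrite opprB [RHS]addrC subrKA.
  rewrite {1}zE linearBl/= cond_exp_orth// sub0r.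
  have /eA [c ->] := zA; rewrite linear_sumr/= big1 ?oppr0// => i _.
  by rewrite linearZr_LR/= xy_orth mulr0.
case: (eqVneq (y - cond_exp A x) 0) => [/eqP|/trdot_gt0/lt0r_neq0/negPf->//].
by rewrite subr_eq0 => /eqP.
Qed.

(** The projection is a sum of rank-one operators; as matrices act on row vectors, the conjugated
    factor stands on the left. *)
Lemma lin_cond_exp I A e w : @orthogonal_basis I A e w ->
  lin_mx (cond_exp A) = \sum_i (w i)^-1 *: ((mxvec (e i))^t* *m mxvec (e i)).
Proof.
move=> eAw; apply/matrixP => x y; rewrite mxE/= (cond_expE _ eAw).
case/mxvec_indexP: x => i j; case/mxvec_indexP: y => k l.
rewrite vec_mx_delta mxvecE !summxE; apply: eq_bigr => s _.
rewrite !mxE big_ord1 !mxE !mxvecE mulrA [_ / w s]mulrC; congr (_ * _ * _).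
(* Row (i, j) is the image of a matrix unit, whose inner product with [e s] is the conjugate of
   entry (i, j) of [e s]. *)
rewrite trdotE (bigD1 i)//= (bigD1 j)//= mxE !eqxx mul1r.
rewrite big1 ?addr0 => [|j' /negPf jj']; last by rewrite mxE jj' andbF mul0r.
rewrite big1 ?addr0// => i' /negPf ii'.
by rewrite big1// => j' _; rewrite mxE ii' mul0r.
Qed.

Lemma mxvec_trdot (x y : 'M[C]_n) : mxvec x *m (mxvec y)^t* = (trdot x y)%:M.
Proof.
apply/matrixP => i j; rewrite !ord1 !mxE mulr1n trdotE pair_bigA/=.
rewrite (reindex _ (curry_mxvec_bij _ _))/=; apply: eq_bigr => -[k l] _ /=.
by rewrite !mxE !mxvecE.
Qed.

(** By cyclicity, the trace of a product of two rank-one operators is an inner product times its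
    conjugate. *)
Lemma Qmeasure_orthogonal_basis (I J : finType) A B
    (e : I -> 'M[C]_n) (f : J -> 'M[C]_n) w v :
  orthogonal_basis A e w -> orthogonal_basis B f v ->
  Qmeasure A B = \sum_i \sum_j (w i * v j)^-1 * `|trdot (e i) (f j)| ^+ 2.
Proof.
move=> eAw fBv; rewrite /Qmeasure (lin_cond_exp eAw) (lin_cond_exp fBv).
rewrite mulmx_suml linear_sum/=; apply: eq_bigr => i _.
rewrite mulmx_sumr linear_sum/=; apply: eq_bigr => j _.
rewrite -scalemxAl -scalemxAr scalerA linearZ/= invfM; congr (_ * _).
rewrite mulmxA -(mulmxA _ _ (_^t*)) mxvec_trdot mxtrace_mulC.
rewrite mulmxA mxvec_trdot -scalar_mxM mxtrace_scalar.
by rewrite trdot_conj normCKC.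
Qed.

Lemma quasiorthogonal_orthogonal_basis (I J : finType) A B
    (e : I -> 'M[C]_n) (f : J -> 'M[C]_n) w v :
  orthogonal_basis A e w -> orthogonal_basis B f v ->
  quasiorthogonal A B <->
  forall i j, \tr (e i *m f j) = \tr (e i) * \tr (f j) / n%:R.
Proof.
move=> eAw fBv; split=> [AB i j|ef x y].
  exact: AB (orthogonal_basis_mem i eAw) (orthogonal_basis_mem j fBv).
have [[_ _ eA] [_ _ fB]] := (eAw, fBv).
move=> /eA[c ->] /fB[c' ->]; rewrite mulmx_suml !linear_sum/= !mulr_suml.
apply: eq_bigr => i _; rewrite mulmx_sumr linear_sum mulr_sumr mulr_suml.
apply: eq_bigr => j _; rewrite -scalemxAl -scalemxAr/= !linearZ/= ef.
by rewrite !mulrA [c i * _ * c' j]mulrAC.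
Qed.

End OrthogonalBasis.

(** * Matrix units of a block-diagonal algebra *)

Lemma trmxC_mul (C : numClosedFieldType) m n p
    (X : 'M[C]_(m, n)) (Y : 'M_(n, p)) :
  (X *m Y)^t* = Y^t* *m X^t*.
Proof. by rewrite trmx_mul map_mxM. Qed.

(** The identity factor forces equal inner indices, so each entry of [y] multiplies a product of two
    column slices of [W]. *)
Lemma mul_tens1 (C : numClosedFieldType) n a m
    (W : 'M[C]_(n, a * m)) (y : 'M[C]_a) :
  W *m (y *t (1%:M : 'M[C]_(m))) *m W^t*
  = \sum_p \sum_q y p q *:
      (colsub (fun j => mxtens_index (p, j)) W
       *m (colsub (fun j => mxtens_index (q, j)) W)^t*).
Proof.
have WyE i q c : (W *m (y *t (1%:M : 'M[C]_(m)))) i (mxtens_index (q, c))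
    = \sum_p W i (mxtens_index (p, c)) * y p q.
  rewrite mxE sum_mxtens_index; apply: eq_bigr => p _.
  rewrite (bigD1 c)//= big1 => [|e /negPf ec].
    by rewrite tensmxE mxE eqxx mulr1 addr0.
  by rewrite tensmxE mxE ec !mulr0.
apply/matrixP => i j; rewrite mxE sum_mxtens_index summxE.
under [RHS]eq_bigr do rewrite summxE.
rewrite [RHS]exchange_big/=; apply: eq_bigr => q _.
under eq_bigr do rewrite WyE mulr_suml.
rewrite exchange_big/=; apply: eq_bigr => p _.
rewrite !mxE mulr_sumr; apply: eq_bigr => c _.
by rewrite !mxE mulrCA mulrA.
Qed.


Section BlockUnits.
Variables (C : numClosedFieldType) (n d : nat) (a m : 'I_d -> nat).
Hypothesis amn : (\sum_(k < d) a k * m k)%N = n.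
Implicit Types (U : 'M[C]_n) (A : {vspace 'M[C]_n}).

Lemma mul_col_block d' (b l : 'I_d' -> nat)
    (bln : (\sum_(k < d') b k * l k)%N = n)
    U (V : 'M[C]_n) k (p : 'I_(a k)) k' (q : 'I_(b k')) i j :
  ((col_block amn U p)^t* *m col_block bln V q) i j
  = (U^t* *m V) (col_pos amn p i) (col_pos bln q j).
Proof.
rewrite !mxE; apply: eq_bigr => x _.
by rewrite !mxE -!col_blockE /col_block !mxE.
Qed.

Lemma mulC_col_block U k (p q : 'I_(a k)) : U \is unitarymx ->
  (col_block amn U p)^t* *m col_block amn U q = ((p == q)%:R)%:M.
Proof.
rewrite -trmxC_unitary => /unitarymxP; rewrite trmxCK => UU.
apply/matrixP => i j; rewrite mul_col_block UU !mxE eq_col_pos eqxx !val_eqE.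
by case: (p == q); case: (i == j).
Qed.

Lemma mulC_col_block_neq U k (p : 'I_(a k)) k' (q : 'I_(a k')) :
  U \is unitarymx -> k != k' ->
  (col_block amn U p)^t* *m col_block amn U q = 0.
Proof.
rewrite -trmxC_unitary => /unitarymxP; rewrite trmxCK => UU /negPf kk'.
by apply/matrixP => i j; rewrite mul_col_block UU !mxE eq_col_pos kk'.
Qed.

Definition block_label := {k : 'I_d & ('I_(a k) * 'I_(a k))%type}.

Lemma sum_block_label (V : nmodType) (F : block_label -> V) :
  \sum_s F s = \sum_k \sum_(p < a k) \sum_(q < a k)
    F (@Tagged _ k (fun k => ('I_(a k) * 'I_(a k))%type) (p, q)).
Proof.
under [RHS]eq_bigr do rewrite pair_big/=.
by rewrite sig_big_dep/=; apply: eq_bigr => -[k [p q]].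
Qed.

(* The image under conjugation by U of the matrix unit E_{p,q} \otimes I_{m_k}
   of the k-th summand, for s = (k, (p, q)). *)
Definition block_unit U (s : block_label) : 'M[C]_n :=
  col_block amn U (tagged s).1 *m (col_block amn U (tagged s).2)^t*.

Lemma block_unit_sum U (y : forall k, 'M[C]_(a k)) :
  U *m castmx (amn, amn) (\mxdiag_(k < d) (y k *t (1%:M : 'M[C]_(m k)))) *m U^t*
  = \sum_s y (tag s) (tagged s).1 (tagged s).2 *: block_unit U s.
Proof.
rewrite sum_block_label/=.
(* Eliminating [amn] replaces [n] by the sum itself, so the casts become trivial. *)
rewrite /block_unit /col_block; case: _ / amn U => U /=; rewrite !castmx_id.
have -> : U^t* = \mxcol_k (submxrow U k)^t*.
  by rewrite -{1}(submxrowK U) tr_mxrow; apply/matrixP => i j; rewrite !mxE.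
rewrite -{1}(submxrowK U) mul_mxrow_mxdiag mul_mxrow_mxcol.
apply: eq_bigr => k _.
exact: mul_tens1.
Qed.

Lemma block_decompositionE U A : block_decomposition amn U A ->
  forall x, x \in A <-> exists y, x = \sum_s y s *: block_unit U s.
Proof.
move=> AE x.
split=> [/AE[y ->]|[y ->]].
  by eexists; rewrite block_unit_sum; reflexivity.
apply/AE; exists (fun k => \matrix_(p, q)
  y (@Tagged _ k (fun k => ('I_(a k) * 'I_(a k))%type) (p, q))).
rewrite block_unit_sum.
by apply: eq_bigr => -[k [p q]] _; rewrite mxE.
Qed.

Lemma mxtrace_block_unit U s : U \is unitarymx ->
  \tr (block_unit U s) = ((tagged s).1 == (tagged s).2)%:R * (m (tag s))%:R.
Proof.
move=> uU; rewrite mxtrace_mulC mulC_col_block// mxtrace_scalar eq_sym.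
by case: eqP; rewrite ?mul0r ?mul0rn ?mul1r.
Qed.

(** Up to cyclicity the inner product involves two products of column blocks, each zero or an
    identity since [U] has orthonormal columns; what survives is the trace of I_{m_k}. *)
Lemma block_unit_orthogonal_basis U A : (forall k, (0 < m k)%N) ->
  U \is unitarymx -> block_decomposition amn U A ->
  orthogonal_basis A (block_unit U) (fun s => (m (tag s))%:R).
Proof.
move=> m_gt0 uU AE; split=> [s|[k [p q]] [k' [p' q']]|];
  last exact: block_decompositionE.
  by rewrite pnatr_eq0 -lt0n.
rewrite /trdot /block_unit/= trmxC_mul trmxCK mulmxA.
rewrite -(mulmxA _ _ (col_block _ _ q')).
have [ek|kk'] := eqVneq k k'.
  case: _ / ek in p' q' *; rewrite eq_Tagged/= xpair_eqE.
  rewrite mulC_col_block// mul_mx_scalar -scalemxAl linearZ/= mxtrace_mulC.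
  rewrite mulC_col_block// mxtrace_scalar [p' == p]eq_sym.
  by case: (p == p'); case: (q == q'); rewrite ?(mul0r, mulr0, mul1r, mul0rn).
rewrite mulC_col_block_neq// mulmx0 mul0mx linear0.
by case: eqP => [[/eqP]|]; rewrite ?(negPf kk') ?mul0r.
Qed.

End BlockUnits.

(** * Two decompositions compared through the matrices of Gamma *)

Lemma unitarymx_row_sum (C : numClosedFieldType) m n (W : 'M[C]_(m, n)) i :
  W \is unitarymx -> \sum_j `|W i j| ^+ 2 = 1.
Proof.
move=> /unitarymxP/matrixP/(_ i i); rewrite mxE [RHS]mxE eqxx mulr1n => <-.
by apply: eq_bigr => j _; rewrite normCK !mxE.
Qed.

Section BlockDecompositions.
Variables (C : numClosedFieldType) (n d1 d2 : nat).
Variables (a m : 'I_d1 -> nat) (b l : 'I_d2 -> nat).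
Hypotheses (amn : (\sum_(k < d1) a k * m k)%N = n)
           (bln : (\sum_(k < d2) b k * l k)%N = n).
Variables U V : 'M[C]_n.

Local Notation G := (Gamma amn bln U V).
Local Notation X := (block_index_mx U V).
Local Notation r := (block_sizes a m).
Local Notation c := (block_sizes b l).
Local Notation label1 i p :=
  (@Tagged _ i (fun k => ('I_(a k) * 'I_(a k))%type) p).
Local Notation label2 j q :=
  (@Tagged _ j (fun k => ('I_(b k) * 'I_(b k))%type) q).

(** Cyclicity moves V_{j,v}^* to the front, where it meets U_{i,p}. *)
Lemma mxtrace_mul_block_unit i j p q u v :
  \tr (block_unit amn U (label1 i (p, q)) *m block_unit bln V (label2 j (u, v)))
  = \tr ((G i j (p, v))^t* *m G i j (q, u)).
Proof.
by rewrite /Gamma /block_unit/= trmxC_mul trmxCK mulmxA mxtrace_mulC !mulmxA.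
Qed.

(** The adjoint of V_{j,u} V_{j,v}^* is V_{j,v} V_{j,u}^*, so [u] and [v] trade places relative to
    [mxtrace_mul_block_unit]. *)
Lemma trdot_block_unit i j p q u v :
  trdot (block_unit amn U (label1 i (p, q)))
    (block_unit bln V (label2 j (u, v)))
  = \tr ((G i j (p, u))^t* *m G i j (q, v)).
Proof.
rewrite -mxtrace_mul_block_unit /trdot; congr (\tr (_ *m _)).
by rewrite /block_unit trmxC_mul trmxCK.
Qed.

Lemma mxtrace_Gamma i j p v :
  \tr ((G i j (p, v))^t* *m G i j (p, v))
  = block_sum r c X (block_pos m p) (block_pos l v).
Proof.
rewrite mxtrace_mulC [LHS]trdotE /block_sum sum_reshape_index.
apply: eq_bigr => x _; rewrite sum_reshape_index; apply: eq_bigr => y _.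
by rewrite -normCK [RHS]mxE -mul_col_block.
Qed.

Lemma frobenius_norm_Ymx :
  frobenius_norm (Ymx r c X) ^+ 2 = \sum_i \sum_j ((m i * l j)%N%:R)^-1 *
    \sum_(p < a i) \sum_(v < b j)
      `|\tr ((G i j (p, v))^t* *m G i j (p, v))| ^+ 2.
Proof.
rewrite sqrtCK sum_block_pos; apply: eq_bigr => i _.
under [RHS]eq_bigr do rewrite mulr_sumr; rewrite [RHS]exchange_big/=.
apply: eq_bigr => p _; rewrite sum_block_pos; apply: eq_bigr => j _.
rewrite mulr_sumr; apply: eq_bigr => v _; rewrite mxE !nth_block_pos.
rewrite normrM exprMn -mxtrace_Gamma; congr (_ * _).
by rewrite ger0_norm ?invr_ge0 ?sqrtC_ge0 ?ler0n// exprVn sqrtCK.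
Qed.

Lemma gamma_diag i j :
  \sum_p \sum_q \sum_u \sum_v `|\tr ((G i j (p, v))^t* *m G i j (q, u))| ^+ 2
  = \sum_p \sum_v `|\tr ((G i j (p, v))^t* *m G i j (p, v))| ^+ 2
    + gamma amn bln U V i j.
Proof.
rewrite -big_split; apply: eq_bigr => p _ /=.
(* For fixed [q] and [u], the condition in [gamma] removes at most the term [v = u], and only when
   [q = p]. *)
have diagE q u (F : 'I_(b j) -> C) : \sum_v F v = (q == p)%:R * F u
    + \sum_(v | (p, v) != (q, u)) F v.
  have [->|/negPf qp] := eqVneq q p; last first.
    rewrite mul0r add0r; apply: eq_bigl => v; by rewrite xpair_eqE eq_sym qp.
  rewrite (bigD1 u)//= mul1r; congr (_ + _).
  by apply: eq_bigl => v; rewrite xpair_eqE eqxx.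
under eq_bigr => q _ do under eq_bigr => u _ do rewrite (diagE q u).
under eq_bigr do rewrite big_split -mulr_sumr/=.
rewrite big_split/=; congr (_ + _).
rewrite (bigD1 p)//= eqxx mul1r [X in _ + X = _]big1 ?addr0// => q /negPf ->.
by rewrite mul0r.
Qed.

Hypotheses (m_gt0 : forall k, (0 < m k)%N) (l_gt0 : forall k, (0 < l k)%N).
Hypotheses (uU : U \is unitarymx) (uV : V \is unitarymx).

(** The rows of the unitary U^*V are unit vectors; column sums are the row sums of its adjoint. *)
Lemma block_index_mx_doubly_stochastic : doubly_stochastic X.
Proof.
have uW : U^t* *m V \is unitarymx by rewrite mul_unitarymx ?trmxC_unitary.
split=> [i j|i|j]; first by rewrite mxE exprn_ge0.
  by rewrite -(unitarymx_row_sum i uW); apply: eq_bigr => j _; rewrite mxE.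
have uWC : (U^t* *m V)^t* \is unitarymx by rewrite trmxC_unitary.
rewrite -(unitarymx_row_sum j uWC); apply: eq_bigr => i _.
by rewrite mxE [((_^t*) : matrix _ _ _) _ _]mxE [(_^T) _ _]mxE norm_conjC.
Qed.

Variables A B : {vspace 'M[C]_n}.
Hypotheses (A_dec : block_decomposition amn U A)
           (B_dec : block_decomposition bln V B).

Let basisA := block_unit_orthogonal_basis m_gt0 uU A_dec.
Let basisB := block_unit_orthogonal_basis l_gt0 uV B_dec.

Lemma Qmeasure_Gamma : Qmeasure A B = \sum_i \sum_j ((m i * l j)%N%:R)^-1 *
  \sum_p \sum_q \sum_u \sum_v `|\tr ((G i j (p, v))^t* *m G i j (q, u))| ^+ 2.
Proof.
rewrite (Qmeasure_orthogonal_basis basisA basisB) sum_block_label.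
apply: eq_bigr => i _; under [RHS]eq_bigr do rewrite mulr_sumr.
rewrite [RHS]exchange_big/=; apply: eq_bigr => p _.
under [RHS]eq_bigr do rewrite mulr_sumr.
rewrite [RHS]exchange_big/=; apply: eq_bigr => q _.
rewrite sum_block_label; apply: eq_bigr => j _.
(* The exchange compensates for the swap of [u] and [v] in [trdot_block_unit]. *)
rewrite exchange_big mulr_sumr; apply: eq_bigr => u _.
rewrite mulr_sumr; apply: eq_bigr => v _.
by rewrite trdot_block_unit natrM.
Qed.

Lemma quasiorthogonal_Gamma : quasiorthogonal A B <->
  forall i j p q u v, \tr ((G i j (p, v))^t* *m G i j (q, u))
    = ((p, v) == (q, u))%:R * ((m i * l j)%N%:R / n%:R).
Proof.
(* The traces vanish unless [p = q] and [u = v], and then equal [m i] and [l j]. *)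
have prodE i j p q u v :
    \tr (block_unit amn U (label1 i (p, q))) *
      \tr (block_unit bln V (label2 j (u, v))) / n%:R
    = ((p, v) == (q, u))%:R * ((m i * l j)%N%:R / n%:R).
  rewrite !mxtrace_block_unit//= xpair_eqE [v == u]eq_sym natrM -mulnb natrM.
  by rewrite mulrACA [RHS]mulrA.
apply: iff_trans (quasiorthogonal_orthogonal_basis basisA basisB) _.
split=> [AB i j p q u v|AB [i [p q]] [j [u v]]].
  by rewrite -mxtrace_mul_block_unit AB prodE.
by rewrite mxtrace_mul_block_unit AB prodE.
Qed.

(** The equations of [quasiorthogonal_Gamma] with equal pairs prescribe the block sums of [X]; those
    with distinct pairs are the orthogonality relations. *)
Lemma quasiorthogonal_iff : quasiorthogonal A B <->
  quasiable r c X /\ forall i j, orthogonal_family (G i j).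
Proof.
apply: iff_trans quasiorthogonal_Gamma _; split=> [GG|[[_ Xb] GG] i j p q u v].
  split; last first.
    move=> i j [p v] [q u] /negPf pvqu.
    by rewrite /trdot mxtrace_mulC GG eq_sym pvqu mul0r.
  split; first exact: block_index_mx_doubly_stochastic.
  (* Every block of [X] is indexed by some (i, p) and (j, v), so the diagonal equations reach all of
     them. *)
  move=> x y; have [i [p ->]] := block_posP x; have [j [v ->]] := block_posP y.
  by rewrite -mxtrace_Gamma GG eqxx mul1r !nth_block_pos.
have [[<- <-]|pvqu] := eqVneq (p, v) (q, u).
  by rewrite mxtrace_Gamma Xb !nth_block_pos mul1r.
by rewrite mul0r mxtrace_mulC; apply: GG; rewrite eq_sym.
Qed.

End BlockDecompositions.

Theorem theorem4p4 (R : realType) (n : nat) (n_gt0 : (0 < n)%N)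
    (A B : {vspace 'M[R[i]]_n}) (U V : 'M[R[i]]_n)
    (d1 d2 : nat) (a m : 'I_d1 -> nat) (b l : 'I_d2 -> nat)
    (a_gt0 : forall k, (0 < a k)%N) (m_gt0 : forall k, (0 < m k)%N)
    (b_gt0 : forall k, (0 < b k)%N) (l_gt0 : forall k, (0 < l k)%N)
    (amn : (\sum_(k < d1) a k * m k)%N = n)
    (bln : (\sum_(k < d2) b k * l k)%N = n)
    (A_alg : unital_star_subalgebra A) (B_alg : unital_star_subalgebra B)
    (U_unitary : U \is unitarymx) (V_unitary : V \is unitarymx)
    (A_dec : block_decomposition amn U A) (B_dec : block_decomposition bln V B) :
  let X := block_index_mx U V in
  let r := block_sizes a m in
  let c := block_sizes b l in
  Qmeasure A B =
    frobenius_norm (Ymx r c X) ^+ 2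
    + \sum_(i < d1) \sum_(j < d2) ((m i * l j)%N%:R)^-1 * gamma amn bln U V i j
  /\
  (quasiorthogonal A B <->
     quasiable r c X /\
     (forall (i : 'I_d1) (j : 'I_d2),
        orthogonal_family (Gamma amn bln U V i j))).
Proof.
split; last exact: quasiorthogonal_iff.
rewrite (Qmeasure_Gamma m_gt0 l_gt0 U_unitary V_unitary A_dec B_dec).
rewrite (frobenius_norm_Ymx amn bln) -big_split; apply: eq_bigr => i _ /=.
rewrite -big_split; apply: eq_bigr => j _ /=.
by rewrite -mulrDr gamma_diag.
Qed.
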